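(* For all integers $\Delta\ge 2$ and $d\ge 1$, in every graph with maximum degree at most $\Delta$, every distance-$d$ semi-ladder has order at most $\Delta^d+1$.
   Context: All graphs are finite, undirected and simple; $\mathrm{dist}$ is the shortest-path distance. For integers $d,\ell\ge 1$, $2\ell$ pairwise distinct vertices $a_1,\dots,a_\ell,b_1,\dots,b_\ell$ of a graph form a distance-$d$ semi-ladder of order $\ell$ if $\mathrm{dist}(b_i,a_j)\le d$ for all $1\le i<j\le \ell$, and $\mathrm{dist}(b_i,a_i)>d$ for every $i\in[1,\ell]$. *)

(* Defs.v *)
(* MathComp *)
From mathcomp Require Import all_boot.

Set Implicit Arguments.
Unset Strict Implicit.
Unset Printing Implicit Defensive.

(* A simple graph on T : finType is a symmetric irreflexive adjacency relation
   e : rel T. *)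
Section Graph.

Variables (T : finType) (e : rel T).

Definition degree (v : T) : nat := #|[set w | e v w]|.

Definition max_degree : nat := \max_(v : T) degree v.

(* The length of a path is its number of edges; the source x is not listed
   in p. *)
Definition has_path (x y : T) (n : nat) : bool :=
  [exists p : n.-tuple T, path e x p && (last x p == y)].

Lemma connect_has_path (x y : T) : connect e x y -> exists n, has_path x y n.
Proof.
case/connectP=> p pth_p ->; exists (size p).
by apply/existsP; exists (in_tuple p); rewrite pth_p eqxx.
Qed.

(* None stands for infinite distance. *)
Definition dist (x y : T) : option nat :=
  match @idP (connect e x y) with
  | ReflectT xy => Some (ex_minn (connect_has_path xy))
  | ReflectF _ => None
  end.

Definition dist_le (x y : T) (d : nat) : bool :=
  if dist x y is Some n then n <= d else false.

Definition dist_gt (x y : T) (d : nat) : bool :=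
  if dist x y is Some n then d < n else true.

Record semi_ladder (d l : nat) (a b : 'I_l -> T) : Prop := SemiLadder {
  semi_ladder_injl : injective a;
  semi_ladder_injr : injective b;
  semi_ladder_disj : forall i j : 'I_l, a i <> b j;
  semi_ladder_le : forall i j : 'I_l, i < j -> dist_le (b i) (a j) d;
  semi_ladder_gt : forall i : 'I_l, dist_gt (b i) (a i) d
}.

Lemma dist_leP (x y : T) (d : nat) :
  reflect (exists p, [/\ path e x p, last x p = y & size p <= d])
          (dist_le x y d).
Proof.
rewrite /dist_le /dist; apply: (iffP idP).
  case: {-}_ / idP => // xy; case: ex_minnP => n /existsP[p /andP[pth /eqP lst]].
  by move=> _ led; exists p; rewrite size_tuple.
case=> p [pth lst led]; case: {-}_ / idP => [xy|[]]; last first.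
  by apply/connectP; exists p.
case: ex_minnP => n _ min_n; apply: leq_trans (min_n (size p) _) led.
by apply/existsP; exists (in_tuple p); rewrite pth lst eqxx.
Qed.

Lemma dist_gtE (x y : T) (d : nat) : dist_gt x y d = ~~ dist_le x y d.
Proof. by rewrite /dist_gt /dist_le; case: dist => // n; rewrite ltnNge. Qed.

End Graph.

(* Main.v *)
(* All of a_2, ..., a_l lie in the ball of radius d around b_1 and differ from
   b_1, so it suffices that such a ball has at most Delta^d + 1 vertices.  A
   vertex on a sphere of positive radius has a neighbour strictly closer to the
   centre, so consecutive spheres grow by a factor of at most Delta - 1; as
   Delta (Delta - 1)^k <= Delta^k (Delta - 1) for k >= 1, the bound follows by
   induction on the radius. *)
Require Import Defs.
From mathcomp Require Import all_boot.

Set Implicit Arguments.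
Unset Strict Implicit.
Unset Printing Implicit Defensive.

Section Balls.

Variables (T : finType) (e : rel T).

Definition ball (x : T) (n : nat) : {set T} := [set y | dist_le e x y n].

Lemma ball0 (x : T) : ball x 0 = [set x].
Proof.
apply/setP=> y; rewrite !inE; apply/dist_leP/eqP => [[p [_ <-]]|->].
  by rewrite leqn0 => /nilP ->.
by exists [::].
Qed.

Lemma ballS (x : T) (n : nat) : ball x n \subset ball x n.+1.
Proof.
apply/subsetP=> y; rewrite !inE => /dist_leP[p [pth lst le_pn]].
by apply/dist_leP; exists p; split=> //; apply: leqW.
Qed.

Lemma ball_edge (x y z : T) (n : nat) :
  y \in ball x n -> e y z -> z \in ball x n.+1.
Proof.
rewrite !inE => /dist_leP[p [pth lst le_pn]] eyz; apply/dist_leP.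
by exists (rcons p z); rewrite rcons_path last_rcons size_rcons pth lst.
Qed.

(** Take the penultimate vertex of a short path to [z]; [z != x] excludes the empty path. *)
Lemma ball_pred (x z : T) (n : nat) :
  z \in ball x n.+1 -> z != x -> exists2 y, y \in ball x n & e y z.
Proof.
rewrite !inE => /dist_leP[p [pth lst le_pn]] zx.
case/lastP: p pth lst le_pn => [_ /= xz|p w].
  by rewrite xz eqxx in zx.
rewrite rcons_path last_rcons size_rcons ltnS => /andP[pth ew] <- le_pn.
by exists (last x p) => //; rewrite inE; apply/dist_leP; exists p.
Qed.

(** The index is shifted by one: these are the vertices at distance exactly [n.+1], so the centre
    lies in no sphere. *)
Definition sphere (x : T) (n : nat) : {set T} := ball x n.+1 :\: ball x n.

Lemma sphere_neq (x y : T) (n : nat) : y \in sphere x n -> y != x.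
Proof.
case/setDP=> _; apply: contraNneq => ->.
by rewrite inE; apply/dist_leP; exists [::].
Qed.

(** A predecessor [y] of [z] inside [ball x n] would put [z] into [ball x n.+1]. Cutting that ball
    out of the neighbourhood of [y] leaves only the outward neighbours. *)
Lemma sphereS_sub (x : T) (n : nat) :
  sphere x n.+1 \subset
    \bigcup_(y in sphere x n) ([set z | e y z] :\: ball x n.+1).
Proof.
apply/subsetP=> z zS; have zx := sphere_neq zS.
case/setDP: zS => zin zout; have [y yin eyz] := ball_pred zin zx.
apply/bigcupP; exists y; last by apply/setDP; rewrite inE.
by apply/setDP; split=> //; apply: contra zout => /ball_edge; apply.
Qed.

Hypothesis e_sym : symmetric e.
Variable Delta : nat.
Hypothesis le_degree : forall v, degree e v <= Delta.

Lemma leq_card_sphere0 (x : T) : #|sphere x 0| <= Delta.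
Proof.
apply: leq_trans (le_degree x); apply/subset_leq_card/subsetP=> z zS.
have zx := sphere_neq zS; case/setDP: zS => zin _.
by have [y] := ball_pred zin zx; rewrite ball0 !inE => /eqP->.
Qed.

Lemma leq_card_sphereS (x : T) (n : nat) :
  #|sphere x n.+1| <= #|sphere x n| * Delta.-1.
Proof.
apply: leq_trans (subset_leq_card (sphereS_sub x n)) _.
apply: leq_trans (_ : \sum_(y in sphere x n) Delta.-1 <= _); last first.
  by rewrite sum_nat_const.
elim/big_rec2: _ => [|y m A yS IH]; first by rewrite cards0.
apply: leq_trans (leq_card_setU _ _) (leq_add _ IH).
have yx := sphere_neq yS; case/setDP: yS => yin _.
(* By symmetry [w] is a neighbour of [y], and it lies in the ball cut out, so at most [Delta - 1]
   neighbours remain. *)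
have [w win ewy] := ball_pred yin yx.
have wN : w \in [set z | e y z] by rewrite inE e_sym.
have lt_D : #|[set z | e y z] :\: ball x n.+1| < Delta.
  apply: leq_trans (le_degree y); apply/proper_card/properP; split.
    exact: subsetDl.
  by exists w => //; rewrite inE (subsetP (ballS x n)).
by rewrite -ltnS (ltn_predK lt_D).
Qed.

Lemma leq_card_sphere (x : T) (n : nat) :
  #|sphere x n| <= Delta * Delta.-1 ^ n.
Proof.
elim: n => [|n IH]; first by rewrite muln1 leq_card_sphere0.
by rewrite expnSr mulnA (leq_trans (leq_card_sphereS x n)) // leq_mul2r IH orbT.
Qed.

Lemma leq_card_ball (x : T) (n : nat) : #|ball x n.+1| <= (Delta ^ n.+1).+1.
Proof.
have cardS m : #|ball x m.+1| <= #|ball x m| + Delta * Delta.-1 ^ m.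
  by rewrite -(cardsID (ball x m)) (setIidPr (ballS x m)) leq_add2l leq_card_sphere.
elim: n => [|n IH]; first by apply: leq_trans (cardS 0) _; rewrite ball0 cards1 muln1.
apply: leq_trans (cardS n.+1) _; apply: leq_trans (leq_add IH (leqnn _)) _.
rewrite addSn ltnS [Delta.-1 ^ _]expnSr mulnA.
apply: leq_trans (_ : Delta ^ n.+1 + Delta ^ n.+1 * Delta.-1 <= _).
  rewrite leq_add2l leq_mul2r [X in _ || (_ <= X)]expnS leq_mul2l.
  by case: n {IH} => [|n]; rewrite ?leqnn ?leq_exp2r ?leq_pred ?orbT.
(* For [Delta = 0] the factor [Delta.-1.+1] is 1 rather than [Delta], but both sides vanish. *)
by rewrite -mulnS [X in _ <= X]expnSr; case: Delta => //; rewrite !exp0n.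
Qed.

End Balls.

Theorem theorem6p1 (Delta d : nat) (hDelta : 2 <= Delta) (hd : 1 <= d)
    (T : finType) (e : rel T) (e_sym : symmetric e) (e_irr : irreflexive e)
    (hdeg : max_degree e <= Delta)
    (l : nat) (hl : 1 <= l) (a b : 'I_l -> T) (hab : semi_ladder e d a b) :
  l <= Delta ^ d + 1.
Proof.
have le_degree v : degree e v <= Delta by exact: leq_trans (leq_bigmax v) hdeg.
case: d hd hab => // d _ hab; case: l hl a b hab => // l _ a b [injA _ disj near _].
rewrite addn1; apply: leq_trans (leq_card_ball e_sym le_degree (b ord0) d).
(* The centre belongs to its own ball; taking it out uses up the extra 1 in the bound on the
   ball. *)
rewrite (cardsD1 (b ord0)).
have -> : b ord0 \in ball e (b ord0) d.+1.
  by rewrite inE; apply/dist_leP; exists [::].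
(* [lift ord0] enumerates the indices after the first, exactly those whose [a] is near [b ord0]. *)
have cardA : #|[set a (lift ord0 i) | i : 'I_l]| = l.
  by rewrite card_imset ?card_ord // => i j /injA /lift_inj.
rewrite add1n ltnS -[X in X <= _]cardA.
apply/subset_leq_card/subsetP=> _ /imsetP[i _ ->].
by rewrite !inE near // andbT; apply/eqP/disj.
Qed.
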